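(* Let $a,b,e$ be integers with $b\ge 1$, $1\le e\le b$ and $a=2b+e$, and let $n\ge 0$. If $C_0,C_n$ are $n$-compatible good sets, then there exists an $(a,b)$-coloring $\varphi$ of the path $P^n$ with $\varphi(0)=C_0$ and $\varphi(n)=C_n$, and such a coloring can be computed in linear time.
   Context: An $(a,b)$-coloring of a graph assigns to each vertex a $b$-element subset of $\{1,\ldots,a\}$ so that adjacent vertices receive disjoint sets. $P^n$ is the path with vertex set $\{0,\ldots,n\}$ and edges $i(i+1)$. A good set is a $b$-element subset of $\{1,\ldots,a\}$. Two good sets $X,Y$ are $k$-compatible (for an integer $k$) if $|X\cap Y|\ge b-e\frac{k}{2}$ when $k$ is even, and $|X\cap Y|\le e\frac{k-1}{2}$ when $k$ is odd. *)

(* Defs.v *)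
From mathcomp Require Import all_boot all_order all_algebra.
Set Implicit Arguments.
Unset Strict Implicit.
Unset Printing Implicit Defensive.

(* The colour set {1, ..., a} is represented by 'I_a, the ordinal i standing
   for the colour i + 1. *)

Definition good (a b : nat) (X : {set 'I_a}) : Prop := #|X| = b.

Definition ab_coloring (T : finType) (adj : rel T) (a b : nat)
    (phi : T -> {set 'I_a}) : Prop :=
  (forall v, good b (phi v)) /\
  (forall u v, adj u v -> [disjoint phi u & phi v]).

Definition path_adj (n : nat) : rel 'I_n.+1 :=
  fun i j => (i.+1 == j :> nat) || (j.+1 == i :> nat).

(* The comparisons are made in int, so that b - e k / 2 may be negative. *)
Definition compatible (a b e : nat) (k : int) (X Y : {set 'I_a}) : Prop :=
  if (2 %| k)%Z
  then (b%:Z - e%:Z * (k %/ 2)%Z <= #|X :&: Y|%:Z)%R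
  else (#|X :&: Y|%:Z <= e%:Z * ((k - 1)%R %/ 2)%Z)%R.

(* Random access machine under the uniform cost criterion: finitely many
   registers are named by a program, the memory is addressed indirectly through
   registers, and the output tape is write-only. Each instruction and each
   evaluation of a test costs one time unit. *)

Inductive instr : Type :=
| Const (r k : nat)
| Add (r s t : nat)
| Sub (r s t : nat)
| Fetch (r s : nat)
| Store (r s : nat)
| Write (r : nat).

Inductive prog : Type :=
| Skip
| Do (i : instr)
| Seq (p q : prog)
| If (r : nat) (p q : prog)
| While (r : nat) (p : prog).

Record state : Type := State {
  reg : nat -> nat;
  mem : nat -> nat;
  out : seq nat
}.

Definition upd (f : nat -> nat) (x y : nat) : nat -> nat :=
  fun z => if z == x then y else f z.

Definition step (i : instr) (s : state) : state :=
  match i with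
  | Const r k => State (upd (reg s) r k) (mem s) (out s)
  | Add r x y => State (upd (reg s) r (reg s x + reg s y)) (mem s) (out s)
  (* truncated subtraction *)
  | Sub r x y => State (upd (reg s) r (reg s x - reg s y)) (mem s) (out s)
  | Fetch r x => State (upd (reg s) r (mem s (reg s x))) (mem s) (out s)
  | Store r x => State (reg s) (upd (mem s) (reg s r) (reg s x)) (out s)
  | Write r => State (reg s) (mem s) (rcons (out s) (reg s r))
  end.

(* [exec p s t s']: started in state s, p halts in state s' after t time units.
   A test on register r succeeds when r is nonzero. *)
Inductive exec : prog -> state -> nat -> state -> Prop :=
| ExecSkip s : exec Skip s 1 s
| ExecDo i s : exec (Do i) s 1 (step i s)
| ExecSeq p q s1 s2 s3 t1 t2 :
    exec p s1 t1 s2 -> exec q s2 t2 s3 -> exec (Seq p q) s1 (t1 + t2) s3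
| ExecIfT r p q s t s' :
    reg s r != 0 -> exec p s t s' -> exec (If r p q) s t.+1 s'
| ExecIfF r p q s t s' :
    reg s r = 0 -> exec q s t s' -> exec (If r p q) s t.+1 s'
| ExecWhileT r p s1 s2 s3 t1 t2 :
    reg s1 r != 0 -> exec p s1 t1 s2 -> exec (While r p) s2 t2 s3 ->
    exec (While r p) s1 (t1 + t2).+1 s3
| ExecWhileF r p s : reg s r = 0 -> exec (While r p) s 1 s.

(* The input word sequence occupies the memory cells from address 0 on. *)
Definition init (inp : seq nat) : state :=
  State (fun=> 0) (fun i => nth 0 inp i) [::].

Definition computes_within (p : prog) (inp outp : seq nat) (T : nat) : Prop :=
  exists t s, [/\ exec p (init inp) t s, out s = outp & t <= T].

(* Sets of colours are encoded by their characteristic vectors, one 0/1 word per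
   colour. *)
Definition charvec (a : nat) (X : {set 'I_a}) : seq nat :=
  [seq nat_of_bool (i \in X) | i <- enum 'I_a].

Definition encode_input (a b n : nat) (C0 Cn : {set 'I_a}) : seq nat :=
  [:: a; b; n] ++ charvec C0 ++ charvec Cn.

Definition encode_output (a n : nat) (phi : 'I_n.+1 -> {set 'I_a}) : seq nat :=
  flatten [seq charvec (phi i) | i <- enum 'I_n.+1].

(* Main.v *)
(** Let [X] be the current set, [Y] the target and [k] the number of edges left
    after the next one.  The next set takes [b] colours outside [X], those of
    [Y] first when [k] is even and those outside [Y] first when [k] is odd.
    Since [X] misses [b + e] colours, in the first case it meets [Y] in
    [b - |X :&: Y|] colours at least, and in the second case in
    [b - e - |X :&: Y|] colours at most, so that compatibility with [Y] is
    preserved; at [k = 0] it says that the set reached is [Y].  The greedy choice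
    takes two scans of the colours, which a random access machine performs in
    place on the characteristic vector of the current set. *)

Require Import Defs.
From mathcomp Require Import all_boot all_order all_algebra.
From mathcomp Require Import zify.

Set Implicit Arguments.
Unset Strict Implicit.
Unset Printing Implicit Defensive.

(** * Greedy selection *)

(** Colour sets become predicates on [nat] so that prefixes can be counted, as the scans of the
    machine do. *)
Definition cnt (E : pred nat) (m : nat) : nat := \sum_(i < m) E i.

Lemma cnt0 (E : pred nat) : cnt E 0 = 0.
Proof. exact: big_ord0. Qed.

Lemma cntS (E : pred nat) m : cnt E m.+1 = cnt E m + E m.
Proof. by rewrite /cnt big_ord_recr. Qed.

Lemma eq_cnt (E F : pred nat) m : (forall i, i < m -> E i = F i) -> cnt E m = cnt F m.
Proof. by move=> eqEF; apply: eq_bigr => i _; rewrite eqEF. Qed.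

Lemma leq_cnt (E F : pred nat) m : (forall i, i < m -> E i -> F i) -> cnt E m <= cnt F m.
Proof.
move=> sEF; apply: leq_sum => i _.
by case: (E i) (sEF i (ltn_ord i)) => // ->.
Qed.

Lemma cntU (E F : pred nat) m : (forall i, i < m -> ~~ (E i && F i)) ->
  cnt (fun i => E i || F i) m = cnt E m + cnt F m.
Proof.
move=> dEF; rewrite /cnt -big_split; apply: eq_bigr => i _ /=.
by case: (E i) (F i) (dEF i (ltn_ord i)) => [] [].
Qed.

Lemma cntID (E F : pred nat) m :
  cnt E m = cnt (fun i => E i && F i) m + cnt (fun i => E i && ~~ F i) m.
Proof.
rewrite -cntU => [|i _]; last by case: (E i) (F i) => [] [].
by apply: eq_cnt => i _; case: (E i) (F i) => [] [].
Qed.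

Lemma cntC (E : pred nat) m : cnt E m + cnt (fun i => ~~ E i) m = m.
Proof.
rewrite -cntU => [|i _]; last by case: (E i).
by elim: m => [|m IH]; rewrite ?cnt0 ?cntS //; case: (E m); lia.
Qed.

(** The first [c] elements of [E], in the form a left-to-right scan with a decreasing counter
    decides. *)
Definition greedy (c : nat) (E : pred nat) : pred nat :=
  fun j => E j && (cnt E j < c).

Lemma cnt_greedy c (E : pred nat) m : cnt (greedy c E) m = minn c (cnt E m).
Proof.
elim: m => [|m IH]; first by rewrite !cnt0 minn0.
by rewrite !cntS IH /greedy; case: (E m) => /=; lia.
Qed.

Definition elig (p : bool) (x y : pred nat) : pred nat :=
  fun j => ~~ x j && (y j == p).

Definition pass1 (b : nat) (p : bool) (x y : pred nat) : pred nat :=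
  greedy b (elig p x y).

Definition rest (b : nat) (p : bool) (x y : pred nat) : pred nat :=
  fun j => ~~ x j && ~~ pass1 b p x y j.

Definition next_set (a b : nat) (p : bool) (x y : pred nat) : pred nat :=
  fun j => pass1 b p x y j ||
           greedy (b - cnt (elig p x y) a) (rest b p x y) j.

Lemma next_set_disjoint a b p (x y : pred nat) j : x j -> next_set a b p x y j = false.
Proof.
by move=> xj; rewrite /next_set /pass1 /greedy /rest /elig xj.
Qed.

Section Next.

Variables (a b e : nat) (p : bool) (x y : pred nat).
Hypotheses (def_a : a = 2 * b + e) (x_b : cnt x a = b).

(** Outside [x] there are [b + e] colours, so when the first pass takes fewer than [b], enough
    remain for the second to fill up. *)
Lemma cnt_next_set : cnt (next_set a b p x y) a = b.
Proof.
have nx : cnt (fun i => ~~ x i) a = b + e by have := cntC x a; lia.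
rewrite cntU => [|i _]; last first.
  by rewrite /greedy /rest; case: (pass1 b p x y i); rewrite ?andbF.
have := cntID (fun i => ~~ x i) (pass1 b p x y) a; rewrite nx.
rewrite -/(rest b p x y) [in X in _ -> X = _]/pass1 !cnt_greedy.
have -> : cnt (fun i => ~~ x i && pass1 b p x y i) a = cnt (pass1 b p x y) a.
  apply: eq_cnt => i _; rewrite /pass1 /greedy /elig.
  by case: (x i).
by rewrite /pass1 cnt_greedy; lia.
Qed.

Lemma cnt_pass1_next_set :
  minn b (cnt (elig p x y) a) <= cnt (fun i => next_set a b p x y i && (y i == p)) a.
Proof.
rewrite -cnt_greedy; apply: leq_cnt => i _.
by move=> fi; rewrite /next_set /pass1 fi /=; case/andP: fi => /andP[].
Qed.

Hypothesis y_b : cnt y a = b.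

(** With [m] common colours, [y] has [b - m] colours outside [x], few enough to be all taken. When
    [p] is false, [e + m] colours avoid both sets, so at least [minn b (e + m)] of the chosen ones
    miss [y]. *)
Lemma next_set_meet :
  if p then b <= cnt (fun i => next_set a b p x y i && y i) a
                 + cnt (fun i => x i && y i) a
  else cnt (fun i => next_set a b p x y i && y i) a + minn b (e + cnt (fun i => x i && y i) a)
       <= b.
Proof.
have := cnt_pass1_next_set; have := cnt_next_set.
have := cntID x y a; have := cntID y x a; have := cntID (fun i => ~~ x i) y a.
have := cntC x a; rewrite x_b y_b.
rewrite (@eq_cnt (fun i => y i && x i) (fun i => x i && y i)) => [|i _]; last exact: andbC.
rewrite (@eq_cnt (fun i => y i && ~~ x i) (fun i => ~~ x i && y i)) => [|i _]; last exact: andbC.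
case: p.
- rewrite (@eq_cnt (elig true x y) (fun i => ~~ x i && y i)) => [|i _]; last first.
    by rewrite /elig eqb_id.
  rewrite (@eq_cnt (fun i => next_set a b true x y i && (y i == true))
             (fun i => next_set a b true x y i && y i)) => [|i _]; last by rewrite eqb_id.
  by lia.
- rewrite (@eq_cnt (elig false x y) (fun i => ~~ x i && ~~ y i)) => [|i _]; last first.
    by rewrite /elig eqbF_neg.
  rewrite (@eq_cnt (fun i => next_set a b false x y i && (y i == false))
             (fun i => next_set a b false x y i && ~~ y i)) => [|i _]; last by rewrite eqbF_neg.
  by have := cntID (next_set a b false x y) y a; lia.
Qed.

End Next.

(** * The greedy colouring of the path *)

Fixpoint col (a b n : nat) (x y : pred nat) (i : nat) : pred nat :=
  if i is i'.+1 then next_set a b (~~ odd (n.+1 - i')) (col a b n x y i') y else x.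

Definition compat (b e k m : nat) : bool :=
  if odd k then m <= e * k./2 else b <= m + e * k./2.

Section Col.

Variables (a b e n : nat) (x y : pred nat).
Hypotheses (def_a : a = 2 * b + e) (x_b : cnt x a = b) (y_b : cnt y a = b).

Lemma cnt_col i : cnt (col a b n x y i) a = b.
Proof. by elim: i => [|i IH] /=; [|apply: (cnt_next_set _ _ def_a IH)]. Qed.

Lemma col_compat i : compat b e n (cnt (fun j => x j && y j) a) -> i <= n ->
  compat b e (n - i) (cnt (fun j => col a b n x y i j && y j) a).
Proof.
move=> cn; elim: i => [|i IH] lt_in; first by rewrite subn0.
have {IH} := IH (ltnW lt_in).
have := next_set_meet (~~ odd (n.+1 - i)) def_a (cnt_col i) y_b.
have -> : n - i = (n - i.+1).+1 by lia.
(* So the bit used by [col] is the parity of the number of edges left after the next one. The form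
   [n.+1 - i] counts the sets still to be written, as register 2 does. *)
have -> : n.+1 - i = (n - i.+1).+2 by lia.
rewrite [col _ _ _ _ _ i.+1]/=.
have -> : n.+1 - i = (n - i.+1).+2 by lia.
rewrite /compat /= !negbK uphalf_half.
(* Once the product is generalized the inequality is linear. *)
by case: (odd _) => /=; rewrite ?add1n ?add0n ?mulnS; move: (e * _); lia.
Qed.

(** At distance 0 compatibility gives at least [b] common colours; both sets have [b], so both
    differences are empty. *)
Lemma col_last j : compat b e n (cnt (fun j => x j && y j) a) -> j < a ->
  col a b n x y n j = y j.
Proof.
move=> cn; have := col_compat cn (leqnn n); rewrite subnn /compat /= muln0 addn0.
set z := col _ _ _ _ _ n => le_b lt_ja.
have zy : cnt (fun i => z i && ~~ y i) a = 0.
  by have := cntID z y a; rewrite cnt_col; lia.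
have yz : cnt (fun i => y i && ~~ z i) a = 0.
  have := cntID y z a; rewrite y_b.
  by rewrite (@eq_cnt (fun i => y i && z i) (fun i => z i && y i)) => [|i _]; [lia|exact: andbC].
have cnt_eq0 (E : pred nat) : cnt E a = 0 -> E j = false.
  move/eqP; rewrite sum_nat_eq0 => /forallP/(_ (Ordinal lt_ja)) /=.
  by case: (E j).
by have := cnt_eq0 _ zy; have := cnt_eq0 _ yz; case: (z j) (y j) => [] [].
Qed.

End Col.

(** * Timed Hoare triples *)

Definition triple (P : state -> Prop) (p : prog) (T : nat) (Q : state -> Prop) : Prop :=
  forall s, P s -> exists t s', [/\ exec p s t s', t <= T & Q s'].

Lemma triple_seq P Q R p q T U :
  triple P p T Q -> triple Q q U R -> triple P (Seq p q) (T + U) R.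
Proof.
move=> hp hq s /hp[t [s' [ep le_t /hq[u [s'' [eq le_u Rs]]]]]].
by exists (t + u), s''; split=> //; [apply: ExecSeq ep eq | apply: leq_add].
Qed.

(* [While] is not interpreted: [run] is meant for loop-free programs. *)
Fixpoint run (p : prog) (s : state) : state :=
  match p with
  | Do i => step i s
  | Seq p q => run q (run p s)
  | If r p q => if reg s r != 0 then run p s else run q s
  | _ => s
  end.

Fixpoint loop_free (p : prog) : bool :=
  match p with
  | Seq p q | If _ p q => loop_free p && loop_free q
  | While _ _ => false
  | _ => true
  end.

Fixpoint cost (p : prog) : nat :=
  match p with
  | Seq p q => cost p + cost q
  | If _ p q => (maxn (cost p) (cost q)).+1
  | _ => 1
  end.

Lemma exec_run p s : loop_free p -> exists2 t, exec p s t (run p s) & t <= cost p.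
Proof.
elim: p s => [|i|p IHp q IHq|r p IHp q IHq|] s //=.
- by exists 1 => //; apply: ExecSkip.
- by exists 1 => //; apply: ExecDo.
- case/andP=> /(IHp s)[t ep le_t] /(IHq (run p s))[u eq le_u].
  by exists (t + u); [apply: ExecSeq ep eq | apply: leq_add].
- case/andP=> /(IHp s)[t ep le_t] /(IHq s)[u eq le_u].
  case: ifPn => [rs|]; last rewrite negbK => /eqP rs.
    by exists t.+1; [apply: ExecIfT | lia].
  by exists u.+1; [apply: ExecIfF | lia].
Qed.

Lemma triple_run (P Q : state -> Prop) p : loop_free p ->
  (forall s, P s -> Q (run p s)) -> triple P p (cost p) Q.
Proof.
move=> lf PQ s Ps; have [t ep le_t] := exec_run s lf.
by exists t, (run p s); split=> //; apply: PQ.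
Qed.

(** Each of the [k] rounds costs one test besides its body, and the failing test adds the final
    unit. *)
Lemma triple_for (I : nat -> state -> Prop) r p T k :
  (forall m s, I m s -> reg s r = m) ->
  (forall m, m < k -> triple (I m.+1) p T (I m)) ->
  triple (I k) (While r p) (k * T.+1).+1 (I 0).
Proof.
move=> Ir; elim: k => [|k IH] hp s Is.
  by exists 1, s; split=> //; apply: ExecWhileF; apply: Ir Is.
have [t [s' [ep le_t /IH]]] := hp k (ltnSn k) s Is.
case=> [m lt_mk|u [s'' [ew le_u I0]]]; first exact: hp (ltnW lt_mk).
exists (t + u).+1, s''; split=> //; last by rewrite mulSn; lia.
by apply: ExecWhileT ep ew; rewrite (Ir _ _ Is).
Qed.

(** * The program *)

Fixpoint seqs (l : seq prog) : prog := if l is p :: l' then Seq p (seqs l') else Skip.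

(* Registers: 0, 1 hold a, b; 2 the number of sets still to be written; 3 the
   constant 1; 4 the number of colours still to be chosen; 5 the loop counter;
   6 the address of the current cell of [X]; 9 the bit telling whether colours of
   [Y] come first; 7, 8 and 10 are scratch. *)
Definition setup_prog : prog :=
  seqs [:: Do (Const 3 1); Do (Fetch 0 0); Do (Fetch 1 3); Do (Add 2 3 3);
           Do (Fetch 2 2); Do (Add 2 2 3); Do (Const 8 0); Do (Add 5 2 8);
           Do (Const 9 1)].

(** The machine has no division, so a parity is found by flipping a bit while counting down. *)
Definition parity_body : prog := seqs [:: Do (Defs.Sub 9 3 9); Do (Defs.Sub 5 5 3)].

Definition mark : prog :=
  seqs [:: Do (Const 8 2); Do (Store 6 8); Do (Defs.Sub 4 4 3)].

(* The current set is written while the preferred colours of its successor are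
   marked by 2. *)
Definition pass1_body : prog :=
  seqs [:: Do (Fetch 7 6); Do (Write 7); Do (Add 10 6 0); Do (Fetch 8 10);
           If 7 Skip (If 4 (If 8 (If 9 mark Skip) (If 9 Skip mark)) Skip);
           Do (Add 6 6 3); Do (Defs.Sub 5 5 3)].

(** A single decrement drops the old colours (1 to 0) and admits the marked ones (2 to 1); cells
    holding 0 are the [rest]. *)
Definition pass2_body : prog :=
  seqs [:: Do (Fetch 7 6);
           If 7 (Do (Defs.Sub 7 7 3))
                (If 4 (Seq (Do (Const 7 1)) (Do (Defs.Sub 4 4 3))) Skip);
           Do (Store 6 7); Do (Add 6 6 3); Do (Defs.Sub 5 5 3)].

Definition start1 : prog :=
  seqs [:: Do (Const 8 0); Do (Add 4 1 8); Do (Add 5 0 8); Do (Const 6 3)].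

Definition start2 : prog :=
  seqs [:: Do (Const 8 0); Do (Add 5 0 8); Do (Const 6 3)].

Definition finish : prog := seqs [:: Do (Defs.Sub 9 3 9); Do (Defs.Sub 2 2 3)].

Definition main_body : prog :=
  Seq start1 (Seq (While 5 pass1_body) (Seq start2 (Seq (While 5 pass2_body) finish))).

Definition main_prog : prog :=
  Seq setup_prog (Seq (While 5 parity_body) (While 2 main_body)).

(** * Invariants of the two scans *)

Definition frame (a b k : nat) (p : bool) (y : pred nat) (s : state) : Prop :=
  [/\ reg s 0 = a, reg s 1 = b, reg s 2 = k, reg s 3 = 1 & reg s 9 = p] /\
  forall i, i < a -> Defs.mem s (3 + a + i) = y i.

Definition word (a : nat) (x : pred nat) : seq nat :=
  [seq nat_of_bool (x i) | i <- iota 0 a].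

Lemma wordS a x : word a.+1 x = rcons (word a x) (x a).
Proof. by rewrite /word -addn1 iotaD map_cat cats1. Qed.

Section Passes.

Variables (a b k : nat) (p : bool) (x y : pred nat) (o : seq nat).

Definition inv1 (m : nat) (s : state) : Prop :=
  exists j, [/\ j + m = a, frame a b k p y s,
    [/\ reg s 4 = b - cnt (elig p x y) j, reg s 5 = m & reg s 6 = 3 + j],
    forall i, i < a ->
      Defs.mem s (3 + i) = if (i < j) && pass1 b p x y i then 2 else x i
    & out s = o ++ word j x].

Definition inv2 (m : nat) (s : state) : Prop :=
  exists j, [/\ j + m = a, frame a b k p y s,
    [/\ reg s 4 = b - cnt (elig p x y) a - cnt (rest b p x y) j,
        reg s 5 = m & reg s 6 = 3 + j],
    forall i, i < a ->
      Defs.mem s (3 + i) = if i < j then next_set a b p x y i : nat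
                      else if pass1 b p x y i then 2 else x i
    & out s = o ++ word a x].

Lemma pass1_bodyP m : triple (inv1 m.+1) pass1_body (cost pass1_body) (inv1 m).
Proof.
apply: triple_run => // -[f g w] [j [jm [[/= f0 f1 f2 f3 f9] gy] [f4 f5 f6] gx ow]].
have lt_ja : j < a by lia.
have gj := gx j lt_ja; rewrite ltnn /= in gj.
have gyj := gy j lt_ja.
(* A copy of [p] to split on, leaving [p] intact inside [elig] and [pass1]. *)
have [q pq] : exists q, q = p by exists p.
have Ej : elig p x y j = ~~ x j && (y j == q) by rewrite pq.
have Mj : pass1 b p x y j = elig p x y j && (b - cnt (elig p x y) j != 0).
  by rewrite /pass1 /greedy subn_eq0 -ltnNge.
have cj := cntS (elig p x y) j.
have wj : word j.+1 x = rcons (word j x) (x j) by rewrite wordS.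
(* The new memory invariant with cell [j] left at its old value; what happens to that cell is
   settled by [Mj]. *)
have gx' i : i < a ->
    g (3 + i) = if (i < j.+1) && pass1 b p x y i && (i != j) then 2 else x i.
  move=> lt_ia; rewrite gx // [in RHS]ltnS [in RHS]leq_eqVlt.
  by case: (eqVneq i j) => [->|_] /=; rewrite ?ltnn ?andbF ?andbT.
have f9q := f9; rewrite -{}pq in f9q.
exists j.+1.
rewrite /run /pass1_body /mark /= /upd /= f6 f0.
rewrite (_ : 3 + j + a = 3 + a + j); last by lia.
rewrite gj gyj f9q f4.
move: Ej Mj gj wj gyj {f9q}; case: (x j); case: (y j); case: q;
  case: (eqVneq (b - cnt (elig p x y) j) 0) => hc /= Ej; rewrite Ej /= => Mj gj wj gyj.
all: split=> /=; [lia | | split; lia | | by rewrite ow wj rcons_cat].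
all: try by split=> //= i /gy <-; case: eqP => //; lia.
all: move=> i lt_ia; rewrite gx' //.
all: case: (eqVneq i j) => [->|ne_ij] /=; rewrite ?eqxx ?Mj ?ltnSn ?andbF ?andbT //=.
all: by rewrite eqn_add2l (negbTE ne_ij).
Qed.

Lemma pass2_bodyP m : triple (inv2 m.+1) pass2_body (cost pass2_body) (inv2 m).
Proof.
apply: triple_run => // -[f g w] [j [jm [[/= f0 f1 f2 f3 f9] gy] [f4 f5 f6] gx ow]].
have lt_ja : j < a by lia.
have gj := gx j lt_ja; rewrite ltnn in gj.
have cj := cntS (rest b p x y) j.
have Zj : next_set a b p x y j = pass1 b p x y j ||
    rest b p x y j && (b - cnt (elig p x y) a - cnt (rest b p x y) j != 0).
  by rewrite /next_set /greedy subn_eq0 -ltnNge.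
have Rj : rest b p x y j = ~~ x j && ~~ pass1 b p x y j by [].
(* This excludes the branch where a colour is both old and marked. *)
have Mx : pass1 b p x y j -> ~~ x j by case/andP=> /andP[].
exists j.+1.
rewrite /run /pass2_body /= /upd /= f6 gj f4.
move: Rj Zj Mx {gj}; case: (x j); case: (pass1 b p x y j);
  case: (eqVneq (b - cnt (elig p x y) a - cnt (rest b p x y) j) 0) => hc /= Rj;
  rewrite ?Rj => Zj; try by move/(_ isT).
all: move=> _; split=> /=; [lia | | split; lia | | by []].
all: try by split=> //= i /gy <-; case: eqP => //; lia.
all: move=> i lt_ia; rewrite f6 eqn_add2l ltnS leq_eqVlt gx //.
all: by case: (eqVneq i j) => [->|] //=; rewrite ?Zj ?f3.
Qed.

End Passes.

(** * The main loop *)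

Lemma start1P a b k p (x y : pred nat) o :
  triple (fun s => [/\ frame a b k p y s, out s = o
                     & forall i, i < a -> Defs.mem s (3 + i) = x i])
    start1 (cost start1) (inv1 a b k p x y o a).
Proof.
apply: triple_run => // -[f g w] [[[/= f0 f1 f2 f3 f9] gy] ow gx].
exists 0; split=> //=; rewrite ?cats0 //.
by split=> //; rewrite /upd /= ?f0 ?f1 ?cnt0; lia.
Qed.

Lemma start2P a b k p (x y : pred nat) o :
  triple (inv1 a b k p x y o 0) start2 (cost start2) (inv2 a b k p x y o a).
Proof.
apply: triple_run => // -[f g w] [j [jm [[/= f0 f1 f2 f3 f9] gy] [f4 f5 f6] gx ow]].
have def_j : j = a by lia.
rewrite {}def_j in jm f4 f6 gx ow.
exists 0; split=> //=.
- by split=> //; rewrite /upd /= ?f0 ?f1 ?cnt0; lia.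
- by move=> i lt_ia; rewrite gx // lt_ia.
Qed.

(** Memory is one set ahead of the output: at [k = 0] it holds a surplus set of index [n.+1], never
    written. *)
Definition main_inv (a b n : nat) (x y : pred nat) (k : nat) (s : state) : Prop :=
  exists i, [/\ i + k = n.+1, frame a b k (~~ odd k) y s,
    forall j, j < a -> Defs.mem s (3 + j) = col a b n x y i j
    & out s = flatten [seq word a (col a b n x y i') | i' <- iota 0 i]].

Lemma finishP a b n k (x y : pred nat) i : i + k = n ->
  triple (inv2 a b k.+1 (~~ odd k.+1) (col a b n x y i) y
            (flatten [seq word a (col a b n x y i') | i' <- iota 0 i]) 0)
    finish (cost finish) (main_inv a b n x y k).
Proof.
move=> ik; apply: triple_run => // -[f g w].
move=> [j [jm [[/= f0 f1 f2 f3 f9] gy] [f4 f5 f6] gx ow]].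
exists i.+1; split; first by lia.
- split=> //=; split=> //; rewrite /upd /= ?f2 ?f3 ?f9; first by lia.
  by case: (odd k).
- move=> i' lt_ia /=; rewrite gx // (_ : i' < j); last by lia.
  by rewrite (_ : n.+1 - i = k.+1) //; lia.
- by rewrite [LHS]ow -[in RHS]addn1 iotaD map_cat flatten_cat /= cats0.
Qed.

Definition main_cost (a : nat) : nat :=
  cost start1 + ((a * (cost pass1_body).+1).+1 +
    (cost start2 + ((a * (cost pass2_body).+1).+1 + cost finish))).

Lemma main_bodyP a b n (x y : pred nat) k :
  triple (main_inv a b n x y k.+1) main_body (main_cost a) (main_inv a b n x y k).
Proof.
move=> s [i [ik fs gx os]].
(* The index [i] is fixed first because the invariants of the scans take the current set and the
   output so far as parameters. *)
have/(_ s): triple (fun s => [/\ frame a b k.+1 (~~ odd k.+1) y s,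
    out s = flatten [seq word a (col a b n x y i') | i' <- iota 0 i]
    & forall j, j < a -> Defs.mem s (3 + j) = col a b n x y i j])
  main_body (main_cost a) (main_inv a b n x y k).
  rewrite /main_body /main_cost.
  apply: triple_seq; first exact: start1P.
  apply: triple_seq.
    apply: triple_for => [m s' [j [_ _ []]]|m _] //; exact: pass1_bodyP.
  apply: triple_seq; first exact: start2P.
  apply: triple_seq.
    apply: triple_for => [m s' [j [_ _ []]]|m _] //; exact: pass2_bodyP.
  by apply: finishP; lia.
by apply.
Qed.

(** * Initialization and the whole program *)

Definition parity_inv (a b n : nat) (x y : pred nat) (m : nat) (s : state) : Prop :=
  exists j, [/\ j + m = n.+1, frame a b n.+1 (~~ odd j) y s, reg s 5 = m,
    forall j, j < a -> Defs.mem s (3 + j) = x j & out s = [::]].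

Lemma parity_bodyP a b n (x y : pred nat) m :
  triple (parity_inv a b n x y m.+1) parity_body (cost parity_body)
    (parity_inv a b n x y m).
Proof.
apply: triple_run => // -[f g w] [j [jm [[/= f0 f1 f2 f3 f9] gy] f5 gx ow]].
exists j.+1; split=> //; [by lia | | by rewrite /= /upd /=; lia].
split=> //=; split=> //; rewrite /upd /= f3 f9.
by case: (odd j).
Qed.

Lemma setupP a b n (x y : pred nat) :
  triple (eq (init ([:: a; b; n] ++ word a x ++ word a y))) setup_prog
    (cost setup_prog) (parity_inv a b n x y n.+1).
Proof.
have szw z : size (word a z) = a by rewrite size_map size_iota.
have nthw z i : i < a -> nth 0 (word a z) i = z i.
  by move=> lt_ia; rewrite (nth_map 0) ?size_iota // nth_iota.
apply: triple_run => // _ <-; exists 0; split=> //=.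
- split=> /=; first by split=> //; rewrite /upd /= addn1.
  move=> i lt_ia; rewrite /= nth_cat szw ltnNge leq_addr /= addKn.
  exact: nthw.
- by rewrite /upd /= addn0 addn1.
- by move=> j lt_ja; rewrite nth_cat szw lt_ja; exact: nthw.
Qed.

Lemma main_progP a b n (x y : pred nat) :
  triple (eq (init ([:: a; b; n] ++ word a x ++ word a y))) main_prog
    (cost setup_prog + ((n.+1 * (cost parity_body).+1).+1
                        + (n.+1 * (main_cost a).+1).+1))
    (fun s => out s = flatten [seq word a (col a b n x y i) | i <- iota 0 n.+1]).
Proof.
apply: triple_seq; first exact: setupP.
apply: triple_seq.
  apply: triple_for => [m s [j [_ _ []]]|m _] //; exact: parity_bodyP.
move=> s [j [jm fs _ gx os]].
have jn : j = n.+1 by lia.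
have Is : main_inv a b n x y n.+1 s by rewrite {}jn in fs; exists 0; split.
have loop : triple (main_inv a b n x y n.+1) (While 2 main_body)
    (n.+1 * (main_cost a).+1).+1 (main_inv a b n x y 0).
  apply: triple_for => [m s' [i [_ [[]]]]|m _] //; exact: main_bodyP.
have [t [s' [ex le_t [i [i0 _ _ os']]]]] := loop s Is.
exists t, s'; split=> //.
by rewrite os' (_ : i = n.+1) //; lia.
Qed.

(** * Transfer to sets of colours *)

Definition nat_pred_of (a : nat) (X : {set 'I_a}) : pred nat :=
  fun j => j \in [seq val i | i <- enum X].

Lemma nat_pred_ofE a (X : {set 'I_a}) (i : 'I_a) : nat_pred_of X i = (i \in X).
Proof. by rewrite /nat_pred_of (mem_map val_inj) mem_enum. Qed.

Lemma card_cnt a (X : {set 'I_a}) (x : pred nat) :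
  (forall i : 'I_a, (i \in X) = x i) -> #|X| = cnt x a.
Proof.
move=> Xx; rewrite -sum1_card /cnt big_mkcond; apply: eq_bigr => i _.
by rewrite Xx; case: (x i).
Qed.

Lemma charvec_word a (X : {set 'I_a}) (x : pred nat) :
  (forall i : 'I_a, (i \in X) = x i) -> charvec X = word a x.
Proof.
move=> Xx; rewrite /charvec /word -val_enum_ord -map_comp.
by apply: eq_map => i /=; rewrite Xx.
Qed.

Lemma compatible_compat a b e n (X Y : {set 'I_a}) :
  compatible b e n%:Z X Y -> compat b e n #|X :&: Y|.
Proof.
rewrite /compatible /compat.
have -> : (2 %| n%:Z)%Z = ~~ odd n by rewrite -dvdn2.
have def_n := odd_double_half n.
case: (odd n) def_n => /= def_n.
- have -> : (((n%:Z - 1)%R %/ 2)%Z = n./2%:Z)%R by lia.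
  by rewrite -PoszM lez_nat.
- have -> : ((n%:Z %/ 2)%Z = n./2%:Z)%R by lia.
  by rewrite -PoszM; move: (e * _); lia.
Qed.

(** The time bound is linear in the length of the output, which is [a * n.+1] words. *)
Lemma main_prog_correct (a b e n : nat) (C0 Cn : {set 'I_a}) :
  1 <= b -> a = 2 * b + e -> good b C0 -> good b Cn -> compatible b e n%:Z C0 Cn ->
  exists phi : 'I_n.+1 -> {set 'I_a},
    [/\ ab_coloring (@path_adj n) b phi, phi ord0 = C0, phi ord_max = Cn
      & computes_within main_prog (encode_input b n C0 Cn) (encode_output phi)
          (100 * (a * n.+1))].
Proof.
move=> b1 def_a g0 gn cmp.
set x := nat_pred_of C0; set y := nat_pred_of Cn.
have C0x (i : 'I_a) : (i \in C0) = x i by rewrite /x nat_pred_ofE.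
have Cny (i : 'I_a) : (i \in Cn) = y i by rewrite /y nat_pred_ofE.
have x_b : cnt x a = b by rewrite -(card_cnt C0x).
have y_b : cnt y a = b by rewrite -(card_cnt Cny).
have cxy : compat b e n (cnt (fun j => x j && y j) a).
  rewrite -(@card_cnt _ (C0 :&: Cn)) => [|i]; first exact: compatible_compat.
  by rewrite inE C0x Cny.
pose phi (i : 'I_n.+1) : {set 'I_a} := [set j : 'I_a | col a b n x y i j].
have phiE i (j : 'I_a) : (j \in phi i) = col a b n x y i j by rewrite inE.
have disj (i j : 'I_n.+1) : i.+1 = j -> [disjoint phi i & phi j].
  move=> ij; apply/pred0P => l /=; rewrite !phiE -ij /=.
  by apply/negP => /andP[xl]; rewrite next_set_disjoint.
exists phi; split.
- split=> [i|i j]; first by rewrite /good (card_cnt (phiE i)) (cnt_col n y def_a x_b).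
  by case/orP=> /eqP /disj //; rewrite disjoint_sym.
- by apply/setP=> j; rewrite phiE C0x.
- by apply/setP=> j; rewrite phiE Cny (col_last def_a x_b y_b cxy).
have [t [s [ex le_t os]]] := @main_progP a b n x y _ erefl.
exists t, s; split=> //.
- by rewrite /encode_input (charvec_word C0x) (charvec_word Cny).
- rewrite os /encode_output -val_enum_ord -map_comp; congr flatten.
  by apply: eq_map => i /=; rewrite (charvec_word (phiE i)).
(* The costs add up to [(26 * a + 19) * n.+1 + 12]; since [a] is positive, the factor 100 is
   ample. *)
- apply: leq_trans le_t _; rewrite /main_cost /=.
  by nia.
Qed.

Theorem theorem8 :
  (forall (a b e n : nat) (C0 Cn : {set 'I_a}),
      1 <= b -> 1 <= e <= b -> a = 2 * b + e ->
      good b C0 -> good b Cn -> compatible b e n%:Z C0 Cn ->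
      exists phi : 'I_n.+1 -> {set 'I_a},
        [/\ ab_coloring (@path_adj n) b phi, phi ord0 = C0 & phi ord_max = Cn])
  /\
  (exists (p : prog) (c : nat),
    forall (a b e n : nat) (C0 Cn : {set 'I_a}),
      1 <= b -> 1 <= e <= b -> a = 2 * b + e ->
      good b C0 -> good b Cn -> compatible b e n%:Z C0 Cn ->
      exists phi : 'I_n.+1 -> {set 'I_a},
        [/\ ab_coloring (@path_adj n) b phi, phi ord0 = C0, phi ord_max = Cn
          & computes_within p (encode_input b n C0 Cn) (encode_output phi)
              (c * (a * n.+1))]).
Proof.
split=> [a b e n C0 Cn b1 _ def_a g0 gn cmp|].
  have [phi [? ? ? _]] := main_prog_correct b1 def_a g0 gn cmp.
  by exists phi.
exists main_prog, 100 => a b e n C0 Cn b1 _ def_a g0 gn cmp.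
exact: main_prog_correct cmp.
Qed.
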